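(* Let $\mathbf{k}$ be a field of characteristic $0$, $n,p\ge 1$ integers, $a\in\mathbf{k}^n$, and $f=(f_1,\dots,f_p)\in\mathbf{k}[x]^p$ with $x=(x_1,\dots,x_n)$; put $F=f_1\cdots f_p$. With the ideals $I_1,I_2,J_1,J_2$ defined in the context, one has $$J_1=D_a[s]\cdot I_1\qquad\text{and}\qquad J_2=\mathbf{k}[x]_a[s]\cdot I_2 .$$
   Context: ''Ideal'' in a noncommutative ring means left ideal. For $A$ one of $\mathbf{k}[x]$, the localization $\mathbf{k}[x]_a$ of $\mathbf{k}[x]$ at $a$ (fractions whose denominators do not vanish at $a$), or $\hat{\mathcal{O}}_{\mathbf{k}^n,a}=\mathbf{k}[[x_1-a_1,\dots,x_n-a_n]]$, let $D_A=A\langle\partial_{x_1},\dots,\partial_{x_n}\rangle$ be the ring of differential operators with coefficients in $A$. Write $D=D_{\mathbf{k}[x]}$, $D_a=D_{\mathbf{k}[x]_a}$, $\hat D_a=D_{\hat{\mathcal{O}}_{\mathbf{k}^n,a}}$. Let $s=(s_1,\dots,s_p)$ be indeterminates and let $\mathcal{L}_A=A[1/F,s]\cdot f^s$ be the free rank-one $A[1/F,s]$-module on the symbol $f^s=f_1^{s_1}\cdots f_p^{s_p}$. It is a $D_A[s]$-module via $\partial_{x_i}\cdot g f^s=\bigl(\frac{\partial g}{\partial x_i}+g\sum_{j=1}^p s_j\frac{\partial f_j}{\partial x_i}f_j^{-1}\bigr)f^s$ for $g\in A[1/F,s]$. Introduce new variables $t=(t_1,\dots,t_p)$ with derivations $\partial_t=(\partial_{t_1},\dots,\partial_{t_p})$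 and set $\hat D_a\langle t,\partial_t\rangle=\hat D_a\otimes_{\mathbf{k}}\mathbf{k}[t]\langle\partial_t\rangle$, with subrings $D\langle t,\partial_t\rangle$ and $D_a\langle t,\partial_t\rangle$ defined likewise. The ring $\hat D_a\langle t,\partial_t\rangle$ (hence its subrings) acts on $\mathcal{L}_{\hat{\mathcal{O}}_{\mathbf{k}^n,a}}$ as follows: elements of $\hat{\mathcal{O}}_{\mathbf{k}^n,a}$ act by multiplication, and for $g=g(s)\in\hat{\mathcal{O}}_{\mathbf{k}^n,a}[1/F,s]$ one has $\partial_{x_i}\cdot g f^s=\bigl(\frac{\partial g}{\partial x_i}+g\sum_{j=1}^p s_j\frac{\partial f_j}{\partial x_i}f_j^{-1}\bigr)f^s$, $t_j\cdot g(s)f^s=g(s_1,\dots,s_j+1,\dots,s_p)f_jf^s$ and $\partial_{t_j}\cdot g(s)f^s=-s_jg(s_1,\dots,s_j-1,\dots,s_p)f_j^{-1}f^s$. The operator $-\partial_{t_j}t_j$ acts as $s_j$, so $s_j$ is identified with $-\partial_{t_j}t_j$, and $D[s]$, $D_a[s]$ are regarded as subrings of $\hat D_a\langle t,\partial_t\rangle$. Define: - $I=\mathrm{ann}_{D\langle t,\partial_t\rangle}(f^s)$ and $J=\mathrm{ann}_{D_a\langle t,\partial_t\rangle}(f^s)$; - $I_1=I\cap D[s]$ and $J_1=J\cap D_a[s]$; - $I_2=(I_1+D[s]\cdot F)\cap\mathbf{k}[x,s]$ and $J_2=(J_1+D_a[s]\cdot F)\cap\mathbf{k}[x]_a[s]$.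 *)

(* Defs.v *)
From HB Require Import structures.
From mathcomp Require Import all_boot all_order all_algebra.
From mathcomp Require Import ring.
From mathcomp Require Import boolp classical_sets.
From mathcomp Require Import ssrcomplements mpoly.

Set Implicit Arguments.
Unset Strict Implicit.
Unset Printing Implicit Defensive.

Import GRing.Theory.
Local Open Scope ring_scope.

Lemma addmAC n (l m r : 'X_{1..n}) : (l + m + r)%MM = (l + r + m)%MM.
Proof. by rewrite -!addmA (addmC m). Qed.

Record pseries (n : nat) (R : comNzRingType) :=
  PSeries { pscoef : 'X_{1..n} -> R }.

Section PSeries.
Variables (n : nat) (R : comNzRingType).
Local Notation ps := (pseries n R).
Implicit Types (u v w : ps) (m : 'X_{1..n}).

HB.instance Definition _ := gen_eqMixin ps.
HB.instance Definition _ := gen_choiceMixin ps.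

Lemma psP u v : pscoef u =1 pscoef v -> u = v.
Proof. by case: u v => [u] [v] /= /funext ->. Qed.

Definition ps_zero : ps := PSeries (fun=> 0).
Definition ps_one : ps := PSeries (fun m => (m == 0%MM)%:R).
Definition ps_opp u : ps := PSeries (fun m => - pscoef u m).
Definition ps_add u v : ps := PSeries (fun m => pscoef u m + pscoef v m).
Definition ps_mul u v : ps := PSeries (fun m =>
  \sum_(l : 'X_{1..n < (mdeg m).+1, (mdeg m).+1} | m == (l.1 + l.2)%MM)
     pscoef u l.1 * pscoef v l.2).

Lemma ps_addA : associative ps_add.
Proof. by move=> u v w; apply: psP => m /=; rewrite addrA. Qed.
Lemma ps_addC : commutative ps_add.
Proof. by move=> u v; apply: psP => m /=; rewrite addrC. Qed.
Lemma ps_add0 : left_id ps_zero ps_add.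
Proof. by move=> u; apply: psP => m /=; rewrite add0r. Qed.
Lemma ps_addN : left_inverse ps_zero ps_opp ps_add.
Proof. by move=> u; apply: psP => m /=; rewrite addNr. Qed.

HB.instance Definition _ :=
  GRing.isZmodule.Build ps ps_addA ps_addC ps_add0 ps_addN.

Lemma pscoefD u v m : pscoef (u + v) m = pscoef u m + pscoef v m.
Proof. by []. Qed.

(* Truncations reduce the ring axioms to those of polynomials. *)
Definition ps_trunc (d : nat) u : {mpoly R[n]} :=
  \sum_(m : 'X_{1..n < d}) pscoef u m *: 'X_[m].

Lemma mcoeff_trunc d u m : (mdeg m < d)%N -> (ps_trunc d u)@_m = pscoef u m.
Proof. by move=> h; rewrite /ps_trunc (mcoeff_mpoly (pscoef u)). Qed.

Lemma eq_mcoeffM (p p' q q' : {mpoly R[n]}) m :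
    (forall l, (mdeg l <= mdeg m)%N -> p@_l = p'@_l) ->
    (forall l, (mdeg l <= mdeg m)%N -> q@_l = q'@_l) ->
  (p * q)@_m = (p' * q')@_m.
Proof.
move=> ep eq; rewrite !mcoeffM; apply: eq_bigr => -[[l1 h1] [l2 h2]] /= /eqP em.
have hm : mdeg m = (mdeg l1 + mdeg l2)%N by rewrite em mdegD.
by rewrite ep ?eq // hm (leq_addr, leq_addl).
Qed.

Lemma ps_mulE d u v m : (mdeg m < d)%N ->
  pscoef (ps_mul u v) m = (ps_trunc d u * ps_trunc d v)@_m.
Proof.
move=> md; rewrite mcoeffM /=; apply: eq_bigr => -[[l1 h1] [l2 h2]] /= /eqP em.
have hm : mdeg m = (mdeg l1 + mdeg l2)%N by rewrite em mdegD.
by rewrite !mcoeff_trunc // (leq_ltn_trans _ md) // hm (leq_addr, leq_addl).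
Qed.

Lemma ps_mulC : commutative ps_mul.
Proof.
by move=> u v; apply: psP => m; rewrite !(@ps_mulE (mdeg m).+1) // mulrC.
Qed.

Lemma ps_mulA : associative ps_mul.
Proof.
move=> u v w; apply: psP => m; set d := (mdeg m).+1.
rewrite !(@ps_mulE d) //.
transitivity ((ps_trunc d u * (ps_trunc d v * ps_trunc d w))@_m).
  by apply: eq_mcoeffM => // l hl; rewrite mcoeff_trunc // (@ps_mulE d).
rewrite mulrA.
by apply: eq_mcoeffM => // l hl; rewrite mcoeff_trunc // (@ps_mulE d).
Qed.

Lemma ps_mul1 : left_id ps_one ps_mul.
Proof.
move=> u; apply: psP => m; rewrite (@ps_mulE (mdeg m).+1) //.
transitivity ((1 * ps_trunc (mdeg m).+1 u)@_m); last by rewrite mul1r mcoeff_trunc.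
by apply: eq_mcoeffM => // l hl; rewrite mcoeff_trunc // mcoeff1.
Qed.

Lemma ps_mulD : left_distributive ps_mul ps_add.
Proof.
move=> u v w; apply: psP => m; rewrite /= -big_split /=.
by apply: eq_bigr => l _; rewrite mulrDl.
Qed.

Lemma ps_one_neq0 : ps_one != 0.
Proof.
apply/eqP => /(congr1 (fun u => pscoef u 0%MM)) /=.
by rewrite eqxx => /eqP; rewrite oner_eq0.
Qed.

HB.instance Definition _ := GRing.Zmodule_isComNzRing.Build ps
  ps_mulA ps_mulC ps_mul1 ps_mulD ps_one_neq0.

Definition ps_der (i : 'I_n) u : ps :=
  PSeries (fun m => pscoef u (m + U_(i))%MM *+ (m i).+1).

Lemma ps_derB i u v : ps_der i (u - v) = ps_der i u - ps_der i v.
Proof. by apply: psP => m; rewrite /= mulrnDl mulNrn. Qed.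

Lemma mcoeff_trunc_der d i u m : (mdeg m < d)%N ->
  pscoef (ps_der i u) m = ((ps_trunc d.+1 u)^`M(i))@_m.
Proof.
move=> h; rewrite mcoeff_deriv mcoeff_trunc //.
by rewrite mdegD mdeg1 addn1.
Qed.

Lemma ps_derM i u v : ps_der i (u * v) = ps_der i u * v + u * ps_der i v.
Proof.
apply: psP => m; set d := (mdeg m).+1.
have -> : pscoef (ps_der i (u * v)) m
        = ((ps_trunc d.+1 u * ps_trunc d.+1 v)^`M(i))@_m.
  rewrite mcoeff_deriv -(@ps_mulE d.+1) //.
  by rewrite mdegD mdeg1 addn1.
rewrite mderivM mcoeffD pscoefD; congr (_ + _).
- rewrite -[_ * v]/(ps_mul _ v) (@ps_mulE d) //; apply: eq_mcoeffM => l hl.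
  + by rewrite [RHS]mcoeff_trunc // (@mcoeff_trunc_der d).
  + by rewrite !mcoeff_trunc // ltnS (leq_trans hl).
- rewrite -[_ * ps_der i v]/(ps_mul u _) (@ps_mulE d) //.
  apply: eq_mcoeffM => l hl.
  + by rewrite !mcoeff_trunc // ltnS (leq_trans hl).
  + by rewrite [RHS]mcoeff_trunc // (@mcoeff_trunc_der d).
Qed.

Lemma ps_derC i j u : ps_der i (ps_der j u) = ps_der j (ps_der i u).
Proof.
apply: psP => m /=; rewrite addmAC -!mulrnA; congr (_ *+ _).
rewrite !mnmDE !mnm1E eq_sym.
by case: eqP => [->|_]; rewrite ?addn0 // mulnC.
Qed.

End PSeries.

Record comm_ders (N : nat) (B : comNzRingType) := CommDers {
  der_fun :> 'I_N -> B -> B;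
  der_additive : forall i a b, der_fun i (a - b) = der_fun i a - der_fun i b;
  der_leibniz : forall i a b,
    der_fun i (a * b) = der_fun i a * b + a * der_fun i b;
  der_comm : forall i j a,
    der_fun i (der_fun j a) = der_fun j (der_fun i a) }.

HB.instance Definition _ N B (d : comm_ders N B) (i : 'I_N) :=
  GRing.isZmodMorphism.Build B B (d i) (@der_additive N B d i).


Definition op_pow (N : nat) (V : Type) (E : 'I_N -> V -> V) (m : 'X_{1..N})
    (v : V) : V :=
  foldr (fun i => iter (m i) (E i)) v (enum 'I_N).

(* P = \sum_m P_m E^m applied to v, a coefficient b acting by sc b. *)
Definition op_act (N : nat) (B : comNzRingType) (V : zmodType)
    (sc : B -> V -> V) (E : 'I_N -> V -> V) (P : {mpoly B[N]}) (v : V) : V :=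
  \sum_(m <- msupp P) sc P@_m (op_pow E m v).

Section OpPow.
Variables (N : nat) (V : Type) (E : 'I_N -> V -> V).
Hypothesis EC : forall i j v, E i (E j v) = E j (E i v).

Lemma op_pow0 v : op_pow E 0%MM v = v.
Proof. by rewrite /op_pow; elim: (enum _) => //= i s ->; rewrite mnm0E. Qed.

Lemma op_powU m i v : op_pow E (m + U_(i))%MM v = E i (op_pow E m v).
Proof.
pose g m s := foldr (fun i => iter (m i) (E i)) v s : V.
have iterC j c w : E i (iter c (E j) w) = iter c (E j) (E i w).
  by elim: c => //= c <-; rewrite EC.
have nin s : i \notin s -> g (m + U_(i))%MM s = g m s.
  elim: s => //= j s IH; rewrite inE negb_or => /andP[ij /IH ->].
  by rewrite mnmDE mnm1E (negbTE ij) addn0.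
have: i \in enum 'I_N by rewrite mem_enum.
have: uniq (enum 'I_N) by rewrite enum_uniq.
rewrite /op_pow -!/(g _ _); elim: (enum _) => //= j s IH /andP[js us].
rewrite inE mnmDE mnm1E iterC; case: eqP => [ij _|_ /= i_s].
  by rewrite -ij in js *; rewrite nin // addn1 iterSr.
by rewrite addn0 IH.
Qed.

End OpPow.

Section OpAct.
Variables (N : nat) (B : comNzRingType) (V : zmodType).
Variables (sc : B -> V -> V) (E : 'I_N -> V -> V).
Hypothesis scDl : forall a b v, sc (a + b) v = sc a v + sc b v.

Lemma sc0l v : sc 0 v = 0.
Proof. by apply: (addrI (sc 0 v)); rewrite -scDl !addr0. Qed.

Lemma op_actE (P : {mpoly B[N]}) k v : (msize P <= k)%N ->
  op_act sc E P v = \sum_(m : 'X_{1..N < k}) sc P@_m (op_pow E m v).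
Proof.
move=> le_pi; rewrite /op_act (big_mksub 'X_{1..N < k}) ?msupp_uniq //=.
  by rewrite big_rmcond //= => j /memN_msupp_eq0 ->; rewrite sc0l.
by move=> x /msize_mdeg_lt /leq_trans; apply.
Qed.

Lemma op_act0 v : op_act sc E 0 v = 0.
Proof. by rewrite /op_act msupp0 big_nil. Qed.

Lemma op_actDl P Q v :
  op_act sc E (P + Q) v = op_act sc E P v + op_act sc E Q v.
Proof.
pose k := maxn (msize (P + Q)) (maxn (msize P) (msize Q)).
rewrite !(@op_actE _ k) ?leq_max ?leqnn ?orbT // -big_split /=.
by apply: eq_bigr => m _; rewrite mcoeffD scDl.
Qed.

Lemma op_actX c m v : op_act sc E (c *: 'X_[m]) v = sc c (op_pow E m v).
Proof.
have [->|c0] := eqVneq c 0; first by rewrite scale0r op_act0 sc0l.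
by rewrite /op_act (msuppMCX _ c0) big_seq1 mcoeffZ mcoeffX eqxx mulr1.
Qed.

Hypothesis scDr : forall a u v, sc a (u + v) = sc a u + sc a v.
Hypothesis scA : forall a b v, sc (a * b) v = sc a (sc b v).
Hypothesis ED : forall i u v, E i (u + v) = E i u + E i v.
Hypothesis EC : forall i j v, E i (E j v) = E j (E i v).

Lemma sc0r a : sc a 0 = 0.
Proof. by apply: (addrI (sc a 0)); rewrite -scDr !addr0. Qed.

Lemma op_actDr P u v : op_act sc E P (u + v) = op_act sc E P u + op_act sc E P v.
Proof.
rewrite /op_act -big_split /=; apply: eq_bigr => m _; rewrite -scDr; congr (sc _ _).
rewrite /op_pow; elim: (enum _) => //= i s ->.
by elim: (m i) => //= c ->; rewrite ED.
Qed.

Lemma op_actZ c P v : op_act sc E (c *: P) v = sc c (op_act sc E P v).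
Proof.
elim/mpolyind: P => [|d m P _ _ IH].
  by rewrite scaler0 op_act0 sc0r.
by rewrite scalerDr !op_actDl IH scDr scalerA !op_actX scA.
Qed.

End OpAct.

Section Diffop.
Variables (N : nat) (B : comNzRingType) (d : comm_ders N B).
Local Notation M := {mpoly B[N]}.

Lemma der0 i : d i 0 = 0. Proof. exact: raddf0. Qed.
Lemma derD i a b : d i (a + b) = d i a + d i b. Proof. exact: raddfD. Qed.
Lemma der1 i : d i 1 = 0.
Proof.
have := der_leibniz d i 1 1; rewrite !mulr1 mul1r => h.
by apply: (addrI (d i 1)); rewrite addr0 -h.
Qed.

(* d_i (\sum_m q_m d^m) = \sum_m (d_i(q_m) d^m + q_m d^m d_i) *)
Definition dop_der (i : 'I_N) (Q : M) : M := map_mpoly (d i) Q + 'X_i * Q.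

Definition dop_mul (P Q : M) : M := op_act *:%R dop_der P Q.

Lemma map_derX i c m : map_mpoly (d i) (c *: 'X_[m]) = d i c *: 'X_[m] :> M.
Proof.
apply/mpolyP => l; rewrite mcoeff_map_mpoly !mcoeffZ !mcoeffX.
by case: eqP => _; rewrite ?mulr1n ?mulr0n ?(mulr1, mulr0) ?raddf0.
Qed.

Lemma dop_derX i c m :
  dop_der i (c *: 'X_[m]) = d i c *: 'X_[m] + c *: 'X_[m + U_(i)].
Proof. by rewrite /dop_der map_derX -scalerAr -mpolyXD addmC. Qed.

Lemma dop_derD i P Q : dop_der i (P + Q) = dop_der i P + dop_der i Q.
Proof. by rewrite /dop_der raddfD /= mulrDr addrACA. Qed.

Lemma dop_derZ i b P : dop_der i (b *: P) = d i b *: P + b *: dop_der i P.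
Proof.
rewrite /dop_der scalerDr addrA -scalerAr; congr (_ + _).
apply/mpolyP => l; rewrite mcoeff_map_mpoly mcoeffD !mcoeffZ mcoeff_map_mpoly.
exact: der_leibniz.
Qed.

Lemma dop_derC i j P : dop_der i (dop_der j P) = dop_der j (dop_der i P).
Proof.
elim/mpolyind: P => [|c m P _ _ IH]; first by rewrite /dop_der !(raddf0, mulr0, addr0).
rewrite (dop_derD j (c *: _)) (dop_derD i (c *: _)).
rewrite (dop_derD i (dop_der _ _)) (dop_derD j (dop_der _ _)) IH; congr (_ + _).
rewrite (dop_derX i c) (dop_derX j c) (dop_derD i (_ *: _)) (dop_derD j (_ *: _)).
rewrite !dop_derX der_comm addmAC -!addrA; congr (_ + _).
by rewrite addrCA.
Qed.

Section Action.
Variables (V : zmodType) (sc : B -> V -> V) (E : 'I_N -> V -> V).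
Hypothesis scDl : forall a b v, sc (a + b) v = sc a v + sc b v.
Hypothesis scDr : forall a u v, sc a (u + v) = sc a u + sc a v.
Hypothesis scA : forall a b v, sc (a * b) v = sc a (sc b v).
Hypothesis ED : forall i u v, E i (u + v) = E i u + E i v.
Hypothesis EZ : forall i b v, E i (sc b v) = sc (d i b) v + sc b (E i v).
Hypothesis EC : forall i j v, E i (E j v) = E j (E i v).

Lemma op_act_der i Q v : op_act sc E (dop_der i Q) v = E i (op_act sc E Q v).
Proof.
elim/mpolyind: Q => [|c m Q _ _ IH].
  rewrite /dop_der raddf0 mulr0 addr0 op_act0.
  by apply: (addrI (E i 0)); rewrite -ED !addr0.
rewrite dop_derD (op_actDl E scDl (dop_der _ _)) IH (op_actDl E scDl (_ *: _) Q).
rewrite ED; congr (_ + _).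
by rewrite dop_derX (op_actDl E scDl (_ *: _)) !(op_actX E scDl) EZ op_powU.
Qed.

Lemma op_act_mul P Q v :
  op_act sc E (dop_mul P Q) v = op_act sc E P (op_act sc E Q v).
Proof.
elim/mpolyind: P => [|c m P _ _ IH]; first by rewrite /dop_mul !op_act0.
have sl a b (u : M) : (a + b) *: u = a *: u + b *: u by rewrite scalerDl.
rewrite (op_actDl E scDl (_ *: _)) -IH /dop_mul (op_actDl _ sl (_ *: _)).
rewrite (op_actDl E scDl (op_act _ _ _ _)); congr (_ + _).
rewrite (op_actX _ sl) (op_actX E scDl) op_actZ //; congr (sc _ _).
rewrite /op_pow; elim: (enum _) => //= i s <-.
by elim: (m i) => //= k <-; rewrite op_act_der.
Qed.

End Action.

Lemma dop_mulA : associative dop_mul.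
Proof.
move=> P Q R; rewrite {1}/dop_mul -op_act_mul //.
- by move=> a b v; rewrite scalerDl.
- by move=> a u v; rewrite scalerDr.
- by move=> a b v; rewrite scalerA.
- exact: dop_derD.
- exact: dop_derZ.
- exact: dop_derC.
Qed.

Lemma dop_mulDl : left_distributive dop_mul +%R.
Proof. by move=> P Q R; apply: op_actDl => a b v; rewrite scalerDl. Qed.

Lemma dop_mulDr : right_distributive dop_mul +%R.
Proof.
move=> P Q R; apply: op_actDr; first by move=> a b v; rewrite scalerDr.
exact: dop_derD.
Qed.

Lemma dop_mul1l : left_id 1 dop_mul.
Proof.
move=> P; rewrite /dop_mul /op_act msupp1 big_seq1 mcoeff1 eqxx scale1r.
exact: op_pow0.
Qed.

Lemma dop_mul1r : right_id 1 dop_mul.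
Proof.
move=> P; rewrite /dop_mul /op_act [RHS]mpolyE; apply: eq_bigr => m _.
congr (_ *: _); rewrite [in RHS](multinomUE_id m) /op_pow -big_enum /=.
elim: (enum _) => [|i s IH] /=; first by rewrite big_nil mpolyX0.
rewrite big_cons IH; elim: (m i) => [|c IHc] /=.
  by rewrite mulm0n add0m.
rewrite IHc -[X in dop_der i X]scale1r dop_derX der1 scale0r add0r scale1r.
by rewrite mulmSr addmAC.
Qed.

End Diffop.

(* The ring B<d_1, ..., d_N>: the free left B-module on the d^m, where        *)
(* d_i b = b d_i + d_i(b); it is carried by {mpoly B[N]}, P@_m being the      *)
(* coefficient of d^m (coefficients on the left), with another product.       *)
Definition diffop (N : nat) (B : comNzRingType) (d : comm_ders N B) : Type :=
  {mpoly B[N]}.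

HB.instance Definition _ N B (d : comm_ders N B) :=
  GRing.Zmodule.copy (diffop d) {mpoly B[N]}.
HB.instance Definition _ N B (d : comm_ders N B) :=
  GRing.Zmodule_isNzRing.Build (diffop d) (dop_mulA d) (dop_mul1l d)
    (dop_mul1r d) (dop_mulDl d) (dop_mulDr d) (oner_neq0 {mpoly B[N]}).

(* R[1/F]: no assumption on F, so this may be the zero ring. *)
Section LocDef.
Variables (R : comNzRingType) (F : R).

Definition loc_rel (u v : R * nat) : bool :=
  `[< exists k, F ^+ k * (u.1 * F ^+ v.2) = F ^+ k * (v.1 * F ^+ u.2) >].

Lemma loc_rel_refl : reflexive loc_rel.
Proof. by move=> u; apply/asboolP; exists 0%N. Qed.

Lemma loc_rel_sym : ssrbool.symmetric loc_rel.
Proof.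
by move=> u v; apply/asboolP/asboolP => -[k e]; exists k; rewrite e.
Qed.

Lemma loc_rel_trans : transitive loc_rel.
Proof.
move=> v u w /asboolP[k e] /asboolP[l e']; apply/asboolP; exists (k + l + v.2)%N.
rewrite !exprD; move: e e'; move: (F ^+ k) (F ^+ l) (F ^+ u.2) (F ^+ v.2).
move: (F ^+ w.2) u.1 v.1 w.1 => W' u1 v1 w1 K L U V e e'.
transitivity (L * W' * (K * (u1 * V))); first by ring.
rewrite e; transitivity (K * U * (L * (v1 * W'))); first by ring.
by rewrite e'; ring.
Qed.

Canonical loc_equiv := EquivRel loc_rel loc_rel_refl loc_rel_sym loc_rel_trans.
Definition loc := {eq_quot loc_equiv}%qT.
HB.instance Definition _ := EqQuotient.on loc.
HB.instance Definition _ := Choice.on loc.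

(* g / F^m *)
Definition loc_frac (g : R) (m : nat) : loc := (\pi_loc (g, m))%qT.

Definition loc_num (u : loc) : R := (repr u).1.
Definition loc_exp (u : loc) : nat := (repr u).2.

End LocDef.
Arguments loc_frac {R} F g m.

Section Loc.
Variables (R : comNzRingType) (F : R).
Local Notation loc := (loc F).
Local Notation frac := (loc_frac F).

Lemma loc_fracP g m h l : frac g m = frac h l <->
  exists k, F ^+ k * (g * F ^+ l) = F ^+ k * (h * F ^+ m).
Proof.
split; first by move/eqmodP/asboolP.
by move=> e; apply/eqmodP/asboolP.
Qed.

Lemma loc_numK u : frac (loc_num u) (loc_exp u) = u.
Proof. by rewrite /loc_frac /loc_num /loc_exp -surjective_pairing reprK. Qed.

Lemma loc_elim u : exists g m, u = frac g m.
Proof. by exists (loc_num u), (loc_exp u); rewrite loc_numK. Qed.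

Lemma loc_fracE g m : exists k, F ^+ k * (loc_num (frac g m) * F ^+ m)
                       = F ^+ k * (g * F ^+ loc_exp (frac g m)).
Proof. by apply/loc_fracP; rewrite loc_numK. Qed.

Definition loc_add (u v : loc) : loc :=
  frac (loc_num u * F ^+ loc_exp v + loc_num v * F ^+ loc_exp u)
       (loc_exp u + loc_exp v).
Definition loc_opp (u : loc) : loc := frac (- loc_num u) (loc_exp u).
Definition loc_mul (u v : loc) : loc :=
  frac (loc_num u * loc_num v) (loc_exp u + loc_exp v).

Lemma loc_addE g m h l :
  loc_add (frac g m) (frac h l) = frac (g * F ^+ l + h * F ^+ m) (m + l).
Proof.
apply/loc_fracP; have [k e] := loc_fracE g m; have [j e'] := loc_fracE h l.
exists (k + j)%N; rewrite !exprD; move: e e'.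
move: (loc_num _) (loc_num _) (F ^+ loc_exp _) (F ^+ loc_exp _).
move: (F ^+ k) (F ^+ j) (F ^+ m) (F ^+ l) => K J M L h' g' L' M' e e'.
transitivity (J * L * L' * (K * (g' * M)) + K * M * M' * (J * (h' * L))).
  by ring.
by rewrite e e'; ring.
Qed.

Lemma loc_oppE g m : loc_opp (frac g m) = frac (- g) m.
Proof.
apply/loc_fracP; have [k e] := loc_fracE g m; exists k.
by rewrite !mulNr !mulrN e.
Qed.

Lemma loc_mulE g m h l : loc_mul (frac g m) (frac h l) = frac (g * h) (m + l).
Proof.
apply/loc_fracP; have [k e] := loc_fracE g m; have [j e'] := loc_fracE h l.
exists (k + j)%N; rewrite !exprD; move: e e'.
move: (loc_num _) (loc_num _) (F ^+ loc_exp _) (F ^+ loc_exp _).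
move: (F ^+ k) (F ^+ j) (F ^+ m) (F ^+ l) => K J M L h' g' L' M' e e'.
transitivity ((K * (g' * M)) * (J * (h' * L))); first by ring.
by rewrite e e'; ring.
Qed.

Lemma loc_addA : associative loc_add.
Proof.
move=> u v w; have [g [m ->]] := loc_elim u; have [h [l ->]] := loc_elim v.
have [i [q ->]] := loc_elim w; rewrite !loc_addE addnA !exprD.
by congr (frac _ _); move: (F ^+ m) (F ^+ l) (F ^+ q) => M L Q; ring.
Qed.

Lemma loc_addC : commutative loc_add.
Proof. by move=> u v; rewrite /loc_add addrC addnC. Qed.

Lemma loc_add0 : left_id (frac 0 0) loc_add.
Proof.
move=> u; have [g [m ->]] := loc_elim u.
by rewrite loc_addE mul0r add0r expr0 mulr1.
Qed.

Lemma loc_addN : left_inverse (frac 0 0) loc_opp loc_add.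
Proof.
move=> u; have [g [m ->]] := loc_elim u; rewrite loc_oppE loc_addE.
by apply/loc_fracP; exists 0%N; rewrite mulNr addNr !mul0r.
Qed.

HB.instance Definition _ :=
  GRing.isZmodule.Build loc loc_addA loc_addC loc_add0 loc_addN.

Lemma loc_mulA : associative loc_mul.
Proof.
move=> u v w; have [g [m ->]] := loc_elim u; have [h [l ->]] := loc_elim v.
by have [i [q ->]] := loc_elim w; rewrite !loc_mulE mulrA addnA.
Qed.

Lemma loc_mulC : commutative loc_mul.
Proof. by move=> u v; rewrite /loc_mul mulrC addnC. Qed.

Lemma loc_mul1 : left_id (frac 1 0) loc_mul.
Proof.
by move=> u; have [g [m ->]] := loc_elim u; rewrite loc_mulE mul1r.
Qed.

Lemma loc_mulDl : left_distributive loc_mul loc_add.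
Proof.
move=> u v w; have [g [m ->]] := loc_elim u; have [h [l ->]] := loc_elim v.
have [i [q ->]] := loc_elim w; rewrite !(loc_addE, loc_mulE).
apply/loc_fracP; exists 0%N; rewrite !exprD expr0.
by move: (F ^+ m) (F ^+ l) (F ^+ q) => M L Q; ring.
Qed.

HB.instance Definition _ := GRing.Zmodule_isComPzRing.Build loc
  loc_mulA loc_mulC loc_mul1 loc_mulDl.

(* The quotient rule, for a derivation d of R *)
Definition loc_der (d : R -> R) (u : loc) : loc :=
  frac (F * d (loc_num u) - (loc_exp u)%:R * loc_num u * d F) (loc_exp u).+1.

(* g / F^m |-> phi(g) / F^m, for an endomorphism phi of R fixing F *)
Definition loc_map (phi : R -> R) (u : loc) : loc :=
  frac (phi (loc_num u)) (loc_exp u).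

Lemma loc_mapE (phi : {rmorphism R -> R}) g m : phi F = F ->
  loc_map phi (frac g m) = frac (phi g) m.
Proof.
move=> phiF; apply/loc_fracP; have [k e] := loc_fracE g m; exists k.
by have := congr1 phi e; rewrite !rmorphM !rmorphXn phiF.
Qed.

Lemma loc_derE (d : {additive R -> R}) g m :
    (forall a b, d (a * b) = d a * b + a * d b) ->
  loc_der d (frac g m) = frac (F * d g - m%:R * g * d F) m.+1.
Proof.
move=> dM; apply/loc_fracP; have [k] := loc_fracE g m.
set g' := loc_num _; set m' := loc_exp _ => e; exists k.+1.
have d1 : d 1 = 0.
  have := dM 1 1; rewrite !mulr1 mul1r => h.
  by apply: (addrI (d 1)); rewrite addr0 -h.
have dX l : F * d (F ^+ l) = l%:R * F ^+ l * d F.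
  elim: l => [|l IH]; first by rewrite expr0 d1; ring.
  rewrite exprS dM mulrDr (mulrCA F F) IH; ring.
have e1 := congr1 d e; rewrite !dM in e1.
move: e1 (dX k) (dX m) (dX m'); rewrite !exprS -/g' -/m'.
move: (d (F ^+ k)) (d (F ^+ m)) (d (F ^+ m')) e.
move: (F ^+ k) (F ^+ m) (F ^+ m') => K M M' dK dM0 dM' e e1 hK hM hM'.
apply/eqP; rewrite -subr_eq0; apply/eqP.
transitivity (F * F * (F * ((dK * (g' * M) + K * (d g' * M + g' * dM0))
      - (dK * (g * M') + K * (d g * M' + g * dM')))
    - (F * dK - k%:R * K * d F) * (g' * M - g * M')
    - K * g' * (F * dM0 - m%:R * M * d F)
    + K * g * (F * dM' - m'%:R * M' * d F)
    - d F * (k%:R + m%:R + m'%:R) * (K * (g' * M) - K * (g * M')))); first by ring.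
by rewrite e1 e hK hM hM'; ring.
Qed.

End Loc.

(* Derivations of A[t_1, ..., t_p] in the order x_1..x_n, t_1..t_p            *)
Section XTDers.
Variables (n p : nat) (A : comNzRingType) (dA : comm_ders n A).

Definition xt_der (i : 'I_(n + p)) (b : {mpoly A[p]}) : {mpoly A[p]} :=
  match split i with
  | inl i => map_mpoly (dA i) b
  | inr j => b^`M(j)
  end.

Lemma xt_derB i a b : xt_der i (a - b) = xt_der i a - xt_der i b.
Proof. by rewrite /xt_der; case: split => j; rewrite raddfB. Qed.

Lemma map_derM i (a b : {mpoly A[p]}) :
  map_mpoly (dA i) (a * b) = map_mpoly (dA i) a * b + a * map_mpoly (dA i) b.
Proof.
apply/mpolyP => m; rewrite mcoeffD mcoeff_map_mpoly !mcoeffM raddf_sum -big_split /=.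
by apply: eq_bigr => l _; rewrite der_leibniz !mcoeff_map_mpoly.
Qed.

Lemma xt_derM i a b : xt_der i (a * b) = xt_der i a * b + a * xt_der i b.
Proof.
by rewrite /xt_der; case: split => j; [apply: map_derM | apply: mderivM].
Qed.

Lemma xt_derC i j a : xt_der i (xt_der j a) = xt_der j (xt_der i a).
Proof.
rewrite /xt_der; case: split => l; case: split => l'.
- by apply/mpolyP => m; rewrite !mcoeff_map_mpoly; apply: der_comm.
- by apply/mpolyP => m; rewrite !(mcoeff_map_mpoly, mcoeff_deriv) raddfMn.
- by apply/mpolyP => m; rewrite !(mcoeff_map_mpoly, mcoeff_deriv) raddfMn.
- exact: mderiv_comm.
Qed.

Definition xt_ders : comm_ders (n + p) {mpoly A[p]} :=
  CommDers xt_derB xt_derM xt_derC.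

(* D_A<t, d_t> = A[t]<d_x, d_t> *)
Definition dop_xt : Type := diffop xt_ders.
HB.instance Definition _ := GRing.NzRing.on dop_xt.

Definition op_cst (c : A) : dop_xt := (c%:MP_[p])%:MP_[n + p].
Definition op_dx (i : 'I_n) : dop_xt := 'X_(lshift p i).
Definition op_t (j : 'I_p) : dop_xt := ('X_j)%:MP_[n + p].
Definition op_dt (j : 'I_p) : dop_xt := 'X_(rshift n j).
Definition op_s (j : 'I_p) : dop_xt := - (op_dt j * op_t j).

End XTDers.

Section FsModule.
Variables (n p : nat) (A : comNzRingType) (dA : comm_ders n A) (f : 'I_p -> A).

(* A[1/F, s] f^s, written as A[s][1/F]; the element g f^s is represented by g *)
Definition fs_module : Type :=
  loc ((\prod_j f j)%:MP : {mpoly A[p]}).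
HB.instance Definition _ := GRing.ComPzRing.on fs_module.

Definition fs_frac (g : {mpoly A[p]}) (m : nat) : fs_module := loc_frac _ g m.
Definition fs_cst (c : A) : fs_module := fs_frac c%:MP 0.
Definition fs_s (j : 'I_p) : fs_module := fs_frac 'X_j 0.
(* 1 / f_j = (\prod_(l != j) f_l) / F *)
Definition fs_inv (j : 'I_p) : fs_module := fs_frac (\prod_(l | l != j) f l)%:MP 1.

(* g(s_1, ..., s_j + c, ..., s_p) *)
Definition fs_shift (c : A) (j : 'I_p) (u : fs_module) : fs_module :=
  loc_map (fun g => g \mPo [tuple 'X_l + (if l == j then c else 0)%:MP | l < p]) u.

Definition fs_dx (i : 'I_n) (u : fs_module) : fs_module :=
  loc_der (map_mpoly (dA i)) u
    + u * \sum_j fs_s j * fs_cst (dA i (f j)) * fs_inv j.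

Definition fs_t (j : 'I_p) (u : fs_module) : fs_module :=
  fs_shift 1 j u * fs_cst (f j).

Definition fs_dt (j : 'I_p) (u : fs_module) : fs_module :=
  - (fs_s j * fs_shift (-1) j u * fs_inv j).

Definition fs_der (i : 'I_(n + p)) : fs_module -> fs_module :=
  match split i with
  | inl i => fs_dx i
  | inr j => fs_dt j
  end.

(* In the first argument the variables of {mpoly A[p]} are t_1, ..., t_p *)
Definition fs_scale : {mpoly A[p]} -> fs_module -> fs_module :=
  op_act (fun c u => fs_cst c * u) fs_t.

Definition fs_act (P : dop_xt p dA) (u : fs_module) : fs_module :=
  op_act fs_scale fs_der P u.

End FsModule.
Arguments fs_act {n p A} dA f P u.

Local Open Scope classical_set_scope.

Definition is_subring (R : nzRingType) (T : set R) : Prop :=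
  [/\ T 1, forall x y, T x -> T y -> T (x - y)
         & forall x y, T x -> T y -> T (x * y)].

Definition subring_gen (R : nzRingType) (S : set R) : set R :=
  smallest (@is_subring R) S.

Definition left_ideal (R : nzRingType) (T X : set R) : set R :=
  [set y | exists s : seq (R * R),
     (forall u, u \in s -> T u.1 /\ X u.2) /\ y = \sum_(u <- s) u.1 * u.2].

Definition set_add (R : nzRingType) (X Y : set R) : set R :=
  [set z | exists x y, [/\ X x, Y y & z = x + y]].

Definition ps_ders (n : nat) (k : comNzRingType) : comm_ders n (pseries n k) :=
  CommDers (@ps_derB n k) (@ps_derM n k) (@ps_derC n k).

Section AtPoint.
Variables (n p : nat) (k : fieldType) (a : 'I_n -> k).
Local Notation Oa := (pseries n k).

(* The expansion at a: h(x) is sent to the series in y = x - a of h(y + a).  *)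
Definition taylor (h : {mpoly k[n]}) : Oa :=
  PSeries (fun m => (h \mPo [tuple 'X_i + (a i)%:MP | i < n])@_m).

Definition kx : set Oa := range taylor.

(* k[x]_a inside k[[x - a]]: taylor h has constant term h(a), hence is a      *)
(* unit when h(a) != 0, and the equation says u = g / h.                      *)
Definition kx_loc : set Oa :=
  [set u | exists g h : {mpoly k[n]}, h.@[a] != 0 /\ taylor h * u = taylor g].

Definition hatD_xt : Type := dop_xt p (ps_ders n k).
HB.instance Definition _ := GRing.NzRing.on hatD_xt.

Local Notation cst := (op_cst p (ps_ders n k) : Oa -> hatD_xt).
Local Notation dx := (op_dx p (ps_ders n k) : 'I_n -> hatD_xt).
Local Notation t := (@op_t n p _ (ps_ders n k) : 'I_p -> hatD_xt).
Local Notation dt := (@op_dt n p _ (ps_ders n k) : 'I_p -> hatD_xt).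
Local Notation s := (@op_s n p _ (ps_ders n k) : 'I_p -> hatD_xt).

(* For a subring A of k[[x - a]], the sets D_ A, D_t A, D_s A and A_s A are   *)
(* D_A, D_A<t, d_t>, D_A[s] and A[s] inside \hat D_a<t, d_t>.                 *)
Definition D_ (A : set Oa) : set hatD_xt :=
  subring_gen (cst @` A `|` range dx).
Definition D_t (A : set Oa) : set hatD_xt :=
  subring_gen (D_ A `|` (range t `|` range dt)).
Definition D_s (A : set Oa) : set hatD_xt := subring_gen (D_ A `|` range s).
Definition A_s (A : set Oa) : set hatD_xt :=
  subring_gen (cst @` A `|` range s).

Variable f : 'I_p -> {mpoly k[n]}.

Definition opF : hatD_xt := cst (taylor (\prod_j f j)).

(* f^s is the element 1 of fs_module. *)
Definition ann_fs (T : set hatD_xt) : set hatD_xt :=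
  [set P | T P /\ fs_act (ps_ders n k) (fun j => taylor (f j)) P 1 = 0].

End AtPoint.
Arguments hatD_xt : clear implicits.

(* Main.v *)
(* An operator P in D_a[s] involves finitely many denominators, so some h in k[x]
   with h(a) != 0 gives h P in D[s]; if P kills f^s then so does h P, and P is
   recovered as h^-1 (h P), with h^-1 in k[x]_a. The same multiplication by a
   common h turns a relation b = P + Q F over k[x]_a into one over k[x]. The
   reverse inclusions only use that f^s generates a left module, i.e. that the
   formulas for the action respect the relations of the Weyl algebra. *)
Require Import Defs.
From mathcomp Require Import all_boot all_order all_algebra.
From mathcomp Require Import ring.
From mathcomp Require Import boolp classical_sets.
From mathcomp Require Import mpoly.

Import GRing.Theory.
Local Open Scope ring_scope.
Local Open Scope classical_set_scope.

Set Implicit Arguments.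
Unset Strict Implicit.
Unset Printing Implicit Defensive.

(** * Polynomial identities reduced to constants and variables *)

Lemma mpoly_ring_ind (N : nat) (B : nzRingType) (P : {mpoly B[N]} -> Prop) :
    (forall c, P c%:MP) -> (forall i, P 'X_i) ->
    (forall u v, P u -> P v -> P (u + v)) ->
    (forall u v, P u -> P v -> P (u * v)) ->
  forall u, P u.
Proof.
move=> PC PX PD PM; elim/mpolyind => [|c m u _ _ Pu]; first by rewrite -mpolyC0.
apply: PD => //; rewrite -mul_mpolyC; apply: (PM) => //.
rewrite mpolyXE_id; apply: (big_ind P) => [|u1 v1|i _].
- by rewrite -mpolyC1.
- exact: PM.
elim: (m i) => [|e IH]; first by rewrite expr0 -mpolyC1.
by rewrite exprS; apply: (PM).
Qed.

Lemma map_mpoly_derX (n p : nat) (A : comNzRingType) (dA : comm_ders n A)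
    (i : 'I_n) (j : 'I_p) :
  map_mpoly (dA i) 'X_j = 0 :> {mpoly A[p]}.
Proof.
apply/mpolyP => m; rewrite mcoeff_map_mpoly mcoeffX mcoeff0.
by case: eqP => _; [exact: der1 | exact: der0].
Qed.

(** * The ring $A[1/F,s]$: generators, shifts in $s$, derivations in $x$ *)

Section FsModuleTheory.
Variables (n p : nat) (A : comNzRingType) (dA : comm_ders n A) (f : 'I_p -> A).
Local Notation V := (fs_module f).
Local Notation C := (fs_cst f).
Local Notation S := (fs_s f).
Local Notation I := (fs_inv f).
Local Notation W := (fs_frac f 1 1).
Local Notation FM := ((\prod_j f j)%:MP : {mpoly A[p]}).

Lemma fs_fracD0 g h : fs_frac f (g + h) 0 = fs_frac f g 0 + fs_frac f h 0.
Proof. by rewrite [RHS]loc_addE expr0 !mulr1. Qed.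

Lemma fs_fracM g m h l : fs_frac f g m * fs_frac f h l = fs_frac f (g * h) (m + l).
Proof. exact: loc_mulE. Qed.

Lemma fs_fracS g m : fs_frac f g m.+1 = fs_frac f g m * W.
Proof. by rewrite fs_fracM mulr1 addn1. Qed.

(** The constants, the $s_j$ and $1/F$ generate $A[1/F,s]$ as a ring. Identities between shifts and
    derivations can thus be checked on generators, without computing with fractions. *)
Lemma fs_ind (P : V -> Prop) :
    (forall c, P (C c)) -> (forall j, P (S j)) -> P W ->
    (forall u v, P u -> P v -> P (u + v)) ->
    (forall u v, P u -> P v -> P (u * v)) ->
  forall u, P u.
Proof.
move=> PC PS PW PD PM u; have [g [m ->]] := loc_elim u.
rewrite -/(fs_frac f g m); elim: m => [|m IH]; last by rewrite fs_fracS; apply: PM.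
elim/mpoly_ring_ind: g => [//|//|g h Pg Ph|g h Pg Ph].
- by rewrite fs_fracD0; apply: PD.
- by rewrite -[0%N]addn0 -fs_fracM; apply: PM.
Qed.

Lemma fs_cstM c d : C (c * d) = C c * C d.
Proof. by rewrite /fs_cst fs_fracM mpolyCM. Qed.

Lemma fs_cstD c d : C (c + d) = C c + C d.
Proof. by rewrite /fs_cst mpolyCD fs_fracD0. Qed.

Lemma fs_cst1 : C 1 = 1.
Proof. by rewrite /fs_cst mpolyC1. Qed.

Lemma fs_cst0 : C 0 = 0.
Proof. by rewrite /fs_cst mpolyC0. Qed.

Lemma fs_cstN c : C (- c) = - C c.
Proof. by apply/eqP; rewrite -addr_eq0 -fs_cstD addNr fs_cst0. Qed.

Lemma fs_WF : W * C (\prod_j f j) = 1.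
Proof.
rewrite fs_fracM; apply/loc_fracP; exists 0%N.
by rewrite expr0 addn0 !mul1r mulr1.
Qed.

Lemma fs_invf j : I j * C (f j) = 1.
Proof.
rewrite fs_fracM -mpolyCM; apply/loc_fracP; exists 0%N.
by rewrite expr0 addn0 !mul1r mulr1 expr1 mulrC [in RHS](bigD1 j).
Qed.

Definition fs_shift_vars (c : A) j :=
  [tuple 'X_l + (if l == j then c else 0)%:MP | l < p].

(** $F$ does not involve $s$, so the substitution $s_j \mapsto s_j + c$ fixes it and passes to
    fractions without changing the denominator. *)
Lemma fs_shiftE c j g m :
  fs_shift c j (fs_frac f g m) = fs_frac f (g \mPo (fs_shift_vars c j)) m.
Proof.
by apply: (loc_mapE (phi := comp_mpoly (fs_shift_vars c j))); rewrite /= comp_mpolyC.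
Qed.

Lemma fs_shiftD c j u v : fs_shift c j (u + v) = fs_shift c j u + fs_shift c j v :> V.
Proof.
have [g [m ->]] := loc_elim u; have [h [l ->]] := loc_elim v.
rewrite [X in fs_shift c j X]loc_addE -!/(fs_frac f _ _) !fs_shiftE.
by rewrite [RHS]loc_addE raddfD /= !rmorphM !rmorphXn /= comp_mpolyC.
Qed.

Lemma fs_shiftM c j u v : fs_shift c j (u * v) = fs_shift c j u * fs_shift c j v :> V.
Proof.
have [g [m ->]] := loc_elim u; have [h [l ->]] := loc_elim v.
by rewrite -!/(fs_frac f _ _) fs_fracM !fs_shiftE fs_fracM rmorphM.
Qed.

Lemma fs_shiftC c j b : fs_shift c j (C b) = C b.
Proof. by rewrite /fs_cst fs_shiftE comp_mpolyC. Qed.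

Lemma fs_shift0 c j : fs_shift c j 0 = 0 :> V.
Proof. by rewrite -fs_cst0 fs_shiftC. Qed.

Lemma fs_shiftN c j (u : V) : fs_shift c j (- u) = - fs_shift c j u.
Proof. by apply/eqP; rewrite -addr_eq0 -fs_shiftD addNr fs_shift0. Qed.

Lemma fs_shiftW c j : fs_shift c j W = W.
Proof. by rewrite fs_shiftE rmorph1. Qed.

Lemma fs_shiftI c j l : fs_shift c j (I l) = I l.
Proof. by rewrite fs_shiftE comp_mpolyC. Qed.

Lemma fs_shiftS c j l : fs_shift c j (S l) = S l + (if l == j then C c else 0).
Proof.
rewrite fs_shiftE comp_mpolyXU -tnth_nth tnth_mktuple fs_fracD0.
by case: eqP => // _; rewrite mpolyC0.
Qed.

Lemma fs_shift_comm c j d l (u : V) :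
  fs_shift c j (fs_shift d l u) = fs_shift d l (fs_shift c j u).
Proof.
elim/fs_ind: u => [b|i||u v Hu Hv|u v Hu Hv].
- by rewrite !fs_shiftC.
- rewrite !fs_shiftS !fs_shiftD !fs_shiftS.
  by case: (i == j); case: (i == l); rewrite -?fs_cst0 !fs_shiftC ?fs_cst0; ring.
- by rewrite !fs_shiftW.
- by rewrite !fs_shiftD Hu Hv.
- by rewrite !fs_shiftM Hu Hv.
Qed.

Lemma fs_shiftNK c j (u : V) : fs_shift c j (fs_shift (- c) j u) = u.
Proof.
elim/fs_ind: u => [b|i||u v Hu Hv|u v Hu Hv].
- by rewrite !fs_shiftC.
- rewrite !fs_shiftS !fs_shiftD !fs_shiftS.
  case: (i == j); rewrite -?fs_cst0 !fs_shiftC ?fs_cst0 ?fs_cstN; ring.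
- by rewrite !fs_shiftW.
- by rewrite !fs_shiftD Hu Hv.
- by rewrite !fs_shiftM Hu Hv.
Qed.

(** The untwisted part of $\partial_{x_i}$, acting on the coefficient $g$ of $g f^s$; the twist by
    $f^s$ is [fs_dlog]. *)
Definition fs_pder (i : 'I_n) : V -> V := loc_der (map_mpoly (dA i)).

Lemma fs_pderE i g m : fs_pder i (fs_frac f g m) =
  fs_frac f (FM * map_mpoly (dA i) g - m%:R * g * (dA i (\prod_j f j))%:MP) m.+1.
Proof. by rewrite -map_mpolyC; apply: loc_derE => b c; apply: map_derM. Qed.

Lemma fs_frac_eq g m h l : g * FM ^+ l = h * FM ^+ m -> fs_frac f g m = fs_frac f h l.
Proof. by move=> e; apply/loc_fracP; exists 0%N; rewrite e. Qed.

Lemma fs_pderD i u v : fs_pder i (u + v) = fs_pder i u + fs_pder i v.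
Proof.
have [g [m ->]] := loc_elim u; have [h [l ->]] := loc_elim v.
rewrite [X in fs_pder i X]loc_addE -!/(fs_frac f _ _) !fs_pderE.
rewrite [RHS]loc_addE raddfD /= !map_derM; apply: fs_frac_eq.
(* The power rule is multiplied by $F$ to avoid the exponent $k-1$. *)
have dX k : FM * map_mpoly (dA i) (FM ^+ k)
          = k%:R * FM ^+ k * (dA i (\prod_j f j))%:MP.
  elim: k => [|k IH]; first by rewrite expr0 -mpolyC1 map_mpolyC /= der1; ring.
  rewrite exprS map_derM mulrDr (mulrCA FM FM) IH map_mpolyC /=; ring.
move: (dX m) (dX l); rewrite !(exprS, exprD) natrD.
move: (map_mpoly _ (FM ^+ m)) (map_mpoly _ (FM ^+ l)) => DM DL.
move: FM (dA i (\prod_j f j))%:MP (map_mpoly _ g) (map_mpoly _ h) => F0 dF dg dh.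
move: (F0 ^+ m) (F0 ^+ l) => M L hM hL.
(* The derivatives of $F^m$ and $F^l$ now occur only multiplied by $F$, the form in which [hM] and
   [hL] eliminate them. *)
transitivity (F0 * F0 * M * L * (F0 * (dg * L + dh * M) + g * (F0 * DL)
  + h * (F0 * DM) - (m%:R + l%:R) * (g * L + h * M) * dF)); first by ring.
by rewrite hM hL; ring.
Qed.

Lemma fs_pderM i u v : fs_pder i (u * v) = fs_pder i u * v + u * fs_pder i v.
Proof.
have [g [m ->]] := loc_elim u; have [h [l ->]] := loc_elim v.
rewrite -!/(fs_frac f _ _) fs_fracM !fs_pderE !fs_fracM.
rewrite [RHS]loc_addE map_derM; apply: fs_frac_eq.
rewrite natrD !addnS !addSn !(exprS, exprD).
move: FM (dA i _)%:MP (map_mpoly _ g) (map_mpoly _ h) => F0 dF dg dh.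
by move: (F0 ^+ m) (F0 ^+ l) => M L; ring.
Qed.

Lemma fs_pderC i c : fs_pder i (C c) = C (dA i c).
Proof.
rewrite fs_pderE map_mpolyC /=; apply: fs_frac_eq.
by rewrite expr0 expr1 mulrC; ring.
Qed.

Lemma fs_pder0 i : fs_pder i 0 = 0.
Proof. by rewrite -fs_cst0 fs_pderC der0. Qed.

Lemma fs_pderN i u : fs_pder i (- u) = - fs_pder i u.
Proof. by apply/eqP; rewrite -addr_eq0 -fs_pderD addNr fs_pder0. Qed.

Lemma fs_pderS i j : fs_pder i (S j) = 0.
Proof.
rewrite fs_pderE -[0]/(fs_frac f 0 0); apply: fs_frac_eq.
rewrite map_mpoly_derX; ring.
Qed.

(** Differentiate $ub = 1$ and multiply by $u$. Both $1/F$ and $1/f_j$ are handled this way instead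
    of by the quotient rule. *)
Lemma fs_pder_inv i u b : u * C b = 1 -> fs_pder i u = - (u * u * C (dA i b)).
Proof.
move=> e; have := congr1 (fs_pder i) e.
rewrite fs_pderM -fs_cst1 !fs_pderC der1 fs_cst0 => /(congr1 (fun x => x * u)).
move/eqP; rewrite mul0r mulrDl addr_eq0 => /eqP h.
by rewrite -[LHS]mulr1 -e mulrA [LHS]mulrAC h mulrAC.
Qed.

Lemma fs_pder_comm i j u : fs_pder i (fs_pder j u) = fs_pder j (fs_pder i u).
Proof.
elim/fs_ind: u => [b|l||u v Hu Hv|u v Hu Hv].
- by rewrite !fs_pderC der_comm.
- by rewrite !fs_pderS !fs_pder0.
- rewrite !(fs_pder_inv _ fs_WF) !fs_pderN !fs_pderM !(fs_pder_inv _ fs_WF) !fs_pderC.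
  by rewrite der_comm; ring.
- by rewrite !fs_pderD Hu Hv.
- rewrite !fs_pderM !fs_pderD !fs_pderM Hu Hv.
  move: (fs_pder j (fs_pder i u)) (fs_pder j (fs_pder i v)) => u2 v2.
  by move: (fs_pder i u) (fs_pder i v) (fs_pder j u) (fs_pder j v) => *; ring.
Qed.

(** Compare on generators: on $s_j$ the shift produces a summand $c$, whose derivative has to
    vanish. In use $c = \pm 1$. *)
Lemma fs_pder_shift i c j u : dA i c = 0 ->
  fs_pder i (fs_shift c j u) = fs_shift c j (fs_pder i u).
Proof.
move=> c0; elim/fs_ind: u => [b|l||u v Hu Hv|u v Hu Hv].
- by rewrite fs_pderC !fs_shiftC fs_pderC.
- rewrite fs_pderS fs_shiftS fs_pderD fs_pderS fs_shift0 add0r.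
  by case: ifP => _; rewrite -?fs_cst0 fs_pderC ?c0 ?der0 fs_cst0.
- by rewrite fs_shiftW (fs_pder_inv _ fs_WF) fs_shiftN !fs_shiftM fs_shiftW fs_shiftC.
- by rewrite fs_pderD !fs_shiftD fs_pderD Hu Hv.
- by rewrite fs_pderM fs_shiftD !fs_shiftM fs_pderM Hu Hv.
Qed.

(** The logarithmic derivative $\partial_{x_i}(f^s)/f^s$. *)
Definition fs_dlog (i : 'I_n) : V := \sum_j S j * C (dA i (f j)) * I j.

Lemma fs_shift_dlog c j i :
  fs_shift c j (fs_dlog i) = fs_dlog i + C c * C (dA i (f j)) * I j.
Proof.
rewrite /fs_dlog (big_morph _ (fs_shiftD c j) (fs_shift0 c j)).
rewrite (bigD1 j) //= [in RHS](bigD1 j) //=.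
rewrite !fs_shiftM !fs_shiftC fs_shiftI fs_shiftS eqxx.
rewrite !mulrDl -[RHS]addrA [in RHS](addrC (bigop _ _ _)) addrA; congr (_ + _).
apply: eq_bigr => l /negbTE lj.
by rewrite !fs_shiftM !fs_shiftC fs_shiftI fs_shiftS lj addr0.
Qed.

(** The form $d\log f^s$ is closed: both sides are $\sum_j s_j(\partial_i\partial_l f_j/f_j -
    \partial_i f_j\,\partial_l f_j/f_j^2)$. *)
Lemma fs_pder_dlog i l : fs_pder i (fs_dlog l) = fs_pder l (fs_dlog i).
Proof.
rewrite /fs_dlog !(big_morph _ (fs_pderD _) (fs_pder0 _)).
apply: eq_bigr => j _; rewrite !fs_pderM !fs_pderS !fs_pderC der_comm.
by rewrite !(fs_pder_inv _ (fs_invf j)); ring.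
Qed.

(** * Relations of the Weyl algebra on $A[1/F,s]f^s$ *)

Lemma fs_dxE i (u : V) : fs_dx dA i u = fs_pder i u + u * fs_dlog i.
Proof. by []. Qed.

Lemma fs_dxD i (u v : V) : fs_dx dA i (u + v) = fs_dx dA i u + fs_dx dA i v.
Proof. by rewrite !fs_dxE fs_pderD; ring. Qed.

Lemma fs_tD j (u v : V) : fs_t j (u + v) = fs_t j u + fs_t j v.
Proof. by rewrite /fs_t fs_shiftD mulrDl. Qed.

Lemma fs_dtD j (u v : V) : fs_dt j (u + v) = fs_dt j u + fs_dt j v.
Proof. by rewrite /fs_dt fs_shiftD; ring. Qed.

(** Flatness of the twisted connection: the untwisted derivations commute and $d\log f^s$ is
    closed. *)
Lemma fs_dxC i l (u : V) : fs_dx dA i (fs_dx dA l u) = fs_dx dA l (fs_dx dA i u).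
Proof.
rewrite !fs_dxE !fs_pderD !fs_pderM fs_pder_comm (fs_pder_dlog i l).
move: (fs_pder l (fs_pder i u)) (fs_pder l (fs_dlog i)) => u2 g2.
by move: (fs_pder i u) (fs_pder l u) (fs_dlog i) (fs_dlog l) => *; ring.
Qed.

Lemma fs_tC j l (u : V) : fs_t j (fs_t l u) = fs_t l (fs_t j u).
Proof. by rewrite /fs_t !fs_shiftM !fs_shiftC fs_shift_comm; ring. Qed.

Lemma fs_dtC j l (u : V) : fs_dt j (fs_dt l u) = fs_dt l (fs_dt j u).
Proof.
have [->//|jl] := eqVneq j l.
(* For $j \ne l$ the shift in $s_l$ leaves the factor $s_j$ unchanged, and conversely. *)
rewrite /fs_dt !fs_shiftN !fs_shiftM !fs_shiftI !fs_shiftS fs_shift_comm.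
by rewrite (negbTE jl) eq_sym (negbTE jl); ring.
Qed.

(** The shift $s_j \mapsto s_j+1$ adds $\partial_i f_j/f_j$ to [fs_dlog i]; after multiplication by
    $f_j$ this is the term that differentiating the factor $f_j$ of [fs_t j] produces. *)
Lemma fs_dx_t i j (u : V) : fs_dx dA i (fs_t j u) = fs_t j (fs_dx dA i u).
Proof.
rewrite /fs_t !fs_dxE fs_pderM fs_pder_shift ?der1 // fs_pderC.
rewrite fs_shiftD fs_shiftM fs_shift_dlog fs_cst1.
set v := fs_shift 1 j u; set w := fs_shift 1 j _.
transitivity (w * C (f j) + v * fs_dlog i * C (f j)
  + v * C (dA i (f j)) * (I j * C (f j))).
  by rewrite fs_invf; ring.
by ring.
Qed.

(** The same cancellation, with the shift by $-1$ and the factor $1/f_j$. *)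
Lemma fs_dx_dt i j (u : V) : fs_dx dA i (fs_dt j u) = fs_dt j (fs_dx dA i u).
Proof.
have d1 : dA i (-1) = 0 by rewrite raddfN /= der1 oppr0.
rewrite /fs_dt !fs_dxE fs_pderN !fs_pderM fs_pder_shift //.
rewrite fs_pderS (fs_pder_inv _ (fs_invf j)) fs_shiftD fs_shiftM fs_shift_dlog.
by rewrite fs_cstN fs_cst1; ring.
Qed.

(** For $l=j$ the two shifts cancel: $\partial_{t_j}t_j$ multiplies by $-s_j$ and
    $t_j\partial_{t_j}$ by $-(s_j+1)$. *)
Lemma fs_dt_t j l (u : V) :
  fs_dt j (fs_t l u) = (if l == j then u else 0) + fs_t l (fs_dt j u).
Proof.
rewrite /fs_t /fs_dt fs_shiftN !fs_shiftM !fs_shiftC !fs_shiftI fs_shiftS.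
rewrite [j == l]eq_sym.
case: eqP => [->|_]; last by rewrite fs_shift_comm; ring.
rewrite (fs_shiftNK 1) -[X in fs_shift (-1) j (fs_shift X _ _)]opprK.
rewrite (fs_shiftNK (-1)) fs_cst1.
transitivity (- (S j * u * (I j * C (f j)))); first by ring.
transitivity (u - (S j + 1) * u * (I j * C (f j))); last by ring.
by rewrite fs_invf; ring.
Qed.

Lemma fs_dxZ i c (u : V) : fs_dx dA i (C c * u) = C (dA i c) * u + C c * fs_dx dA i u.
Proof. by rewrite !fs_dxE fs_pderM fs_pderC; ring. Qed.

Lemma fs_tZ j c (u : V) : fs_t j (C c * u) = C c * fs_t j u.
Proof. by rewrite /fs_t fs_shiftM fs_shiftC mulrA. Qed.

Lemma fs_dtZ j c (u : V) : fs_dt j (C c * u) = C c * fs_dt j u.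
Proof. by rewrite /fs_dt fs_shiftM fs_shiftC; ring. Qed.

(** * From relations between generators to an action of $D_A\langle t,\partial_t\rangle$ *)

Let cDl a b (v : V) : C (a + b) * v = C a * v + C b * v.
Proof. by rewrite fs_cstD mulrDl. Qed.
Let cDr a (u v : V) : C a * (u + v) = C a * u + C a * v.
Proof. exact: mulrDr. Qed.
Let cA a b (v : V) : C (a * b) * v = C a * (C b * v).
Proof. by rewrite fs_cstM mulrA. Qed.

Lemma fs_scaleDl a b (v : V) : fs_scale (a + b) v = fs_scale a v + fs_scale b v.
Proof. exact: op_actDl. Qed.

Lemma fs_scaleDr a (u v : V) : fs_scale a (u + v) = fs_scale a u + fs_scale a v.
Proof. by apply: op_actDr => //; apply: fs_tD. Qed.

Lemma fs_scaleC c (v : V) : fs_scale c%:MP v = C c * v.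
Proof. by rewrite -alg_mpolyC -mpolyX0 /fs_scale op_actX // op_pow0. Qed.

(** On a monomial, multiplication by $t_j$ raises one exponent, and the extra [fs_t j] can be moved
    to the front because these maps commute. *)
Lemma fs_scaleXM j b (v : V) : fs_scale ('X_j * b) v = fs_t j (fs_scale b v).
Proof.
have t0 : fs_t j 0 = 0 :> V by apply: (addrI (fs_t j 0)); rewrite -fs_tD !addr0.
elim/mpolyind: b => [|c m b _ _ IH].
  by rewrite mulr0 /fs_scale op_act0 t0.
rewrite mulrDr fs_scaleDl IH (fs_scaleDl (c *: _)) fs_tD; congr (_ + _).
rewrite -scalerAr -mpolyXD addmC /fs_scale !op_actX // fs_tZ op_powU //.
exact: fs_tC.
Qed.

Lemma fs_scaleX j (v : V) : fs_scale 'X_j v = fs_t j v.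
Proof.
by rewrite -[X in fs_scale X]mulr1 fs_scaleXM -mpolyC1 fs_scaleC fs_cst1 mul1r.
Qed.

Lemma fs_scaleA a b (v : V) : fs_scale (a * b) v = fs_scale a (fs_scale b v).
Proof.
elim/mpoly_ring_ind: a b v => [c|j|a a' H H'|a a' H H'] b v.
- by rewrite mul_mpolyC fs_scaleC; apply: op_actZ.
- by rewrite fs_scaleXM fs_scaleX.
- by rewrite mulrDl !fs_scaleDl H H'.
- by rewrite -mulrA H H' H.
Qed.

Lemma fs_derD i (u v : V) : fs_der dA i (u + v) = fs_der dA i u + fs_der dA i v.
Proof. by rewrite /fs_der; case: split => j; rewrite (fs_dxD, fs_dtD). Qed.

Lemma fs_derC i j (v : V) : fs_der dA i (fs_der dA j v) = fs_der dA j (fs_der dA i v).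
Proof.
rewrite /fs_der; case: split => l; case: split => m; rewrite ?fs_dx_dt //.
- exact: fs_dxC.
- exact: fs_dtC.
Qed.

(** The relation $\partial_i b = \partial_i(b) + b\,\partial_i$ read on the module, as [op_act_mul]
    demands. It is stable under sums and products in [b], which leaves constants and the $t_j$. *)
Lemma fs_derZ i b (v : V) :
  fs_der dA i (fs_scale b v) =
    fs_scale (xt_ders p dA i b) v + fs_scale b (fs_der dA i v).
Proof.
elim/mpoly_ring_ind: b v => [c|j|b b' H H'|b b' H H'] v.
- rewrite !fs_scaleC /fs_der /= /xt_der; case: split => l.
    by rewrite fs_dxZ map_mpolyC fs_scaleC.
  by rewrite fs_dtZ mderivC fs_scaleC fs_cst0 mul0r add0r.
- rewrite !fs_scaleX /fs_der /= /xt_der; case: split => l.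
    by rewrite map_mpoly_derX -mpolyC0 fs_scaleC fs_cst0 mul0r add0r fs_dx_t.
  rewrite mderivX mnm1E fs_dt_t; congr (_ + _).
  case: eqP => [->|_]; last by rewrite scale0r -mpolyC0 fs_scaleC fs_cst0 mul0r.
  (* The derivative of $t_j$ carries the monomial of exponent $U_j - U_j = 0$, that is $1$. *)
  rewrite scale1r -[X in (X - _)%MM]add0m addmK mpolyX0.
  by rewrite -mpolyC1 fs_scaleC fs_cst1 mul1r.
- by rewrite derD !fs_scaleDl fs_derD H H'; ring.
- by rewrite der_leibniz fs_scaleDl !fs_scaleA H H' fs_scaleDr; ring.
Qed.

(** The relations above are the hypotheses of [op_act_mul]. This compatibility makes annihilators of
    $f^s$ stable under left multiplication. *)
Lemma fs_actM (P Q : dop_xt p dA) (v : V) :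
  fs_act dA f (P * Q) v = fs_act dA f P (fs_act dA f Q v).
Proof.
apply: op_act_mul.
- exact: fs_scaleDl.
- exact: fs_scaleDr.
- exact: fs_scaleA.
- exact: fs_derD.
- exact: fs_derZ.
- exact: fs_derC.
Qed.

Lemma fs_actDl (P Q : dop_xt p dA) (v : V) :
  fs_act dA f (P + Q) v = fs_act dA f P v + fs_act dA f Q v.
Proof. by apply: op_actDl => *; apply: fs_scaleDl. Qed.

Lemma fs_actDr (P : dop_xt p dA) (u v : V) :
  fs_act dA f P (u + v) = fs_act dA f P u + fs_act dA f P v.
Proof. by apply: op_actDr; [apply: fs_scaleDr | apply: fs_derD]. Qed.

Lemma fs_act0 (P : dop_xt p dA) : fs_act dA f P 0 = 0.
Proof. by apply: (addrI (fs_act dA f P 0)); rewrite -fs_actDr !addr0. Qed.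

End FsModuleTheory.

(** * Taylor expansion at $a$ and inverses of polynomials not vanishing at $a$ *)

Section Taylor.
Variables (n : nat) (k : fieldType) (a : 'I_n -> k).
Implicit Types (g h : {mpoly k[n]}).

Lemma mcoeff0M (B : comNzRingType) (g h : {mpoly B[n]}) :
  (g * h)@_0%MM = g@_0%MM * h@_0%MM.
Proof.
transitivity ((g@_0%MM)%:MP * (h@_0%MM)%:MP : {mpoly B[n]})@_0%MM.
  by apply: eq_mcoeffM => l; rewrite mdeg0 leqn0 mdeg_eq0 => /eqP ->;
     rewrite mcoeffC eqxx mulr1.
by rewrite -mpolyCM mcoeffC eqxx mulr1.
Qed.

(** Each factor without constant term raises the order by at least one. *)
Lemma mcoeffX_lt (B : comNzRingType) (w : {mpoly B[n]}) e m :
  w@_0%MM = 0 -> (mdeg m < e)%N -> (w ^+ e)@_m = 0.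
Proof.
move=> w0; elim: e m => // e IH m; rewrite ltnS => le_m.
rewrite exprS mcoeffM big1 // => -[[l1 h1] [l2 h2]] /= /eqP em.
have [->|l1n0] := eqVneq l1 0%MM; first by rewrite w0 mul0r.
rewrite (IH l2) ?mulr0 //; apply: leq_trans le_m.
by rewrite em mdegD -[X in (X < _)%N]add0n ltn_add2r lt0n mdeg_eq0.
Qed.

Lemma taylor1 : taylor a 1 = 1.
Proof. by apply: psP => m; rewrite /= rmorph1 mcoeff1. Qed.

Lemma taylorM g h : taylor a (g * h) = taylor a g * taylor a h.
Proof.
apply: psP => m; rewrite [RHS](@ps_mulE _ _ (mdeg m).+1) //= rmorphM.
by apply: eq_mcoeffM => l hl; rewrite mcoeff_trunc.
Qed.

Lemma taylor_coef0 h : (h \mPo [tuple 'X_i + (a i)%:MP | i < n])@_0%MM = h.@[a].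
Proof.
elim/mpoly_ring_ind: h => [c|i|u v Hu Hv|u v Hu Hv].
- by rewrite comp_mpolyC mcoeffC eqxx mulr1 mevalC.
- rewrite comp_mpolyXU -tnth_nth tnth_mktuple mevalXU mcoeffD mcoeffC eqxx mulr1.
  by rewrite mcoeffX -mdeg_eq0 mdeg1 add0r.
- by rewrite raddfD mcoeffD Hu Hv mevalD.
- by rewrite rmorphM mcoeff0M Hu Hv mevalM.
Qed.

(* Geometric series: if g = h(x + a) and w = 1 - g / g(0), then w has no constant
   term and 1 / g = (1 / g(0)) \sum_i w^i. *)
Lemma taylor_inv h : h.@[a] != 0 -> exists v, taylor a h * v = 1.
Proof.
rewrite -taylor_coef0; set g := h \mPo _; set c := g@_0%MM => c0.
pose w : {mpoly k[n]} := 1 - c^-1 *: g.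
have w0 : w@_0%MM = 0 by rewrite mcoeffB mcoeffZ mcoeff1 eqxx mulVf ?subrr.
pose s d : {mpoly k[n]} := c^-1 *: \sum_(i < d) w ^+ i.
have gs d : g * s d = 1 - w ^+ d.
  rewrite /s -scalerAr scalerAl -opprB subrX1 -mulNr opprB.
  by rewrite /w opprB addrCA subrr addr0.
(* The coefficient at [m] is read in the partial sum with [(mdeg m).+1] terms, since later powers of
   [w] start in higher degree. *)
exists (PSeries (fun m => (s (mdeg m).+1)@_m)); apply: psP => m.
set d := (mdeg m).+1; rewrite [LHS](@ps_mulE _ _ d) //.
transitivity ((g * s d)@_m).
  apply: eq_mcoeffM => l hl; rewrite mcoeff_trunc //= /s !mcoeffZ; congr (_ * _).
  rewrite -(subnKC (hl : ((mdeg l).+1 <= d)%N)) big_split_ord /= mcoeffD.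
  rewrite [X in _ = _ + X]raddf_sum /= [X in _ = _ + X]big1 ?addr0 // => i _.
  by rewrite mcoeffX_lt // ltnS leq_addr.
by rewrite gs mcoeffB mcoeffX_lt // subr0 mcoeff1.
Qed.

End Taylor.

(** * Subrings, left ideals and clearing of denominators in an abstract ring *)

Section Subrings.
Variable R : nzRingType.
Implicit Types (T X : set R).

Lemma subring0 T : is_subring T -> T 0.
Proof. by case=> T1 TB _; rewrite -(subrr 1); apply: TB. Qed.

Lemma subringN T x : is_subring T -> T x -> T (- x).
Proof.
move=> rT Tx; rewrite -sub0r; case: (rT) => _ TB _.
by apply: TB => //; apply: subring0.
Qed.

Lemma subringD T x y : is_subring T -> T x -> T y -> T (x + y).
Proof.
move=> rT Tx Ty; rewrite -[y]opprK; case: (rT) => _ TB _.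
by apply: TB => //; apply: subringN.
Qed.

Lemma subringM T x y : is_subring T -> T x -> T y -> T (x * y).
Proof. by case=> _ _; apply. Qed.

(** Elements of $I_1 + D[s]F$ have the shape [x + y * z] with [z] equal to $F$; this identity and
    the next keep that shape under left multiples and sums. *)
Lemma mulrDMA (u x y z : R) : u * (x + y * z) = u * x + u * y * z.
Proof. by rewrite mulrDr mulrA. Qed.

Lemma addrDMl (x x' y y' z : R) :
  (x + y * z) + (x' + y' * z) = (x + x') + (y + y') * z.
Proof. by rewrite mulrDl addrACA. Qed.

Lemma subringMA T g h x : is_subring T -> T g -> T (h * x) -> T (g * h * x).
Proof. by move=> rT Tg Thx; rewrite -mulrA; apply: subringM. Qed.

Lemma subring_gen_subring X : is_subring (subring_gen X).
Proof.
split=> [T [[]]//|x y Xx Xy T|x y Xx Xy T] [rT XT]; case: (rT) => _ TB TM.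
- by apply: TB; [apply: Xx | apply: Xy].
- by apply: TM; [apply: Xx | apply: Xy].
Qed.

Lemma sub_subring_gen X : X `<=` subring_gen X.
Proof. exact: sub_smallest. Qed.

Lemma subring_gen_min T X : is_subring T -> X `<=` T -> subring_gen X `<=` T.
Proof. exact: smallest_sub. Qed.

Lemma left_ideal_mul T X u x : T u -> X x -> left_ideal T X (u * x).
Proof.
move=> Tu Xx; exists [:: (u, x)]; rewrite big_seq1; split=> // v.
by rewrite inE => /eqP ->.
Qed.

Lemma left_ideal_min T X Y :
    Y 0 -> (forall x y, Y x -> Y y -> Y (x + y)) ->
    (forall u x, T u -> X x -> Y (u * x)) ->
  left_ideal T X `<=` Y.
Proof.
move=> Y0 YD YM _ [s [sP ->]].
rewrite big_seq; apply: (big_ind Y) => [|x y|u /sP[]].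
- exact: Y0.
- exact: YD.
- exact: YM.
Qed.

(** In a sum of left multiples of one element that element factors out on the right, and [T] is
    closed under addition. *)
Lemma left_ideal1P T x y : is_subring T ->
  left_ideal T [set x] y <-> exists2 u, T u & y = u * x.
Proof.
move=> rT; split=> [|[u Tu ->]]; last exact: left_ideal_mul.
apply: (@left_ideal_min T [set x] [set y | exists2 u, T u & y = u * x])
  => [|_ _ [u Tu ->] [v Tv ->]|u _ Tu ->].
- by exists 0; rewrite ?mul0r //; apply: subring0.
- by exists (u + v); rewrite ?mulrDl //; apply: subringD.
- by exists u.
Qed.

Section Denominators.
Variables (T H : set R).
Hypotheses (rT : is_subring T) (HT : H `<=` T) (H1 : H 1).
Hypothesis HM : forall g h, H g -> H h -> H (g * h).
Hypothesis HC : forall g h, H g -> H h -> g * h = h * g.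

(** Informally $x \in H^{-1}T$. *)
Definition clears x := exists2 h, H h & T (h * x).

(** A denominator need not commute with an operator, so [clears] is not visibly stable under
    products. This stronger property is, by composition. *)
Definition left_clears y := forall x, clears x -> clears (y * x).

(** For a difference, the product of the two denominators clears both terms because elements of [H]
    commute. *)
Lemma left_clears_subring : is_subring left_clears.
Proof.
split=> [x|y z cy cz x cx|y z cy cz x cx]; first by rewrite mul1r.
- have [g Hg Tg] := cy _ cx; have [h Hh Th] := cz _ cx.
  exists (g * h); first exact: HM.
  rewrite mulrBl mulrBr {1}HC // -!mulrA; case: (rT) => _ TB TM.
  by apply: TB; apply: TM => //; apply: HT.
- by rewrite -mulrA; apply: cy; apply: cz.
Qed.

Lemma left_clears1 y : left_clears y -> clears y.
Proof.
move=> cy; rewrite -[y]mulr1; apply: cy; exists 1; rewrite ?mulr1 //.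
exact: HT.
Qed.

(* g h^2 (y x) = h (g y) (h x) - g [y, h] (h x), and g [y, h] = (g y) h - h (g y)
   lies in T although [y, h] itself need not. *)
Lemma left_clears_gen g y : H g -> T (g * y) ->
  (forall h, H h -> h * (y * h - h * y) = (y * h - h * y) * h) -> left_clears y.
Proof.
move=> Hg Tgy yC x [h Hh Thx]; exists (g * (h * h)); first by do !apply: HM => //.
have Th := HT Hh.
have -> : g * (h * h) * (y * x)
  = h * (g * y) * (h * x) - ((g * y) * h - h * (g * y)) * (h * x).
  pose c := y * h - h * y; have hC : h * c = c * h by apply: yC.
  have hg : h * (g * y) = g * (h * y) by rewrite mulrA (HC Hh Hg) -mulrA.
  have hyx : h * (y * x) = y * (h * x) - c * x.
    by rewrite mulrBl opprB addrC -!mulrA subrK.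
  rewrite hg -[g * y * h]mulrA -mulrBr -/c -!mulrA hyx -mulrBr; congr (_ * _).
  by rewrite mulrBr ![h * (c * x)]mulrA hC -!mulrA.
case: (rT) => _ TB TM.
by apply: (TB); [|apply: (TM) => //; apply: (TB)]; do !apply: (TM) => //.
Qed.

End Denominators.
End Subrings.
Arguments subring_gen_subring {R} X.

(** * Commutation with coefficients in the ring of differential operators *)

Section OpAlgebra.
Variables (n p : nat) (A : comNzRingType) (dA : comm_ders n A).
Local Notation D := (dop_xt p dA).
Local Notation cst := (op_cst p dA).

(** The operator product differs from the polynomial product of the carrier. With a coefficient or a
    single derivation on the left it reduces to scaling or to [dop_der], from which the relations
    below are read off. *)
Lemma dop_mulCl (b : {mpoly A[p]}) (Q : {mpoly {mpoly A[p]}[n + p]}) :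
  dop_mul (xt_ders p dA) b%:MP Q = b *: Q.
Proof.
rewrite -alg_mpolyC -mpolyX0 /dop_mul op_actX ?op_pow0 // => c d v.
exact: scalerDl.
Qed.

Lemma dop_mulXl i (Q : {mpoly {mpoly A[p]}[n + p]}) :
  dop_mul (xt_ders p dA) 'X_i Q = dop_der (xt_ders p dA) i Q.
Proof.
rewrite -['X_i]scale1r -[U_(i)%MM]add0m /dop_mul op_actX => [|c d v].
  by rewrite scale1r (op_powU (@dop_derC _ _ _)) op_pow0.
exact: scalerDl.
Qed.

Lemma dop_derCst i (b : {mpoly A[p]}) :
  dop_der (xt_ders p dA) i b%:MP = (xt_ders p dA i b)%:MP + b *: 'X_i.
Proof. by rewrite /dop_der map_mpolyC /= mulrC mul_mpolyC. Qed.

Lemma op_cstM c d : cst (c * d) = cst c * cst d.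
Proof.
rewrite [RHS]dop_mulCl -mul_mpolyC /op_cst.
by rewrite !mpolyCM.
Qed.

Lemma op_cst1 : cst 1 = 1.
Proof. by rewrite /op_cst !mpolyC1. Qed.

Lemma op_dx_cst i c : op_dx p dA i * cst c = cst (dA i c) + cst c * op_dx p dA i.
Proof.
rewrite [LHS]dop_mulXl dop_derCst [X in _ = _ + X]dop_mulCl /= /xt_der.
by rewrite (unsplitK (inl i)) map_mpolyC.
Qed.

Lemma op_dt_cst j c : op_dt dA j * cst c = cst c * op_dt dA j.
Proof.
rewrite [LHS]dop_mulXl dop_derCst [RHS]dop_mulCl /= /xt_der.
by rewrite (unsplitK (inr j)) mderivC mpolyC0 add0r.
Qed.

Lemma op_t_cst j c : op_t dA j * cst c = cst c * op_t dA j.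
Proof.
by rewrite [LHS]dop_mulCl [RHS]dop_mulCl -!mul_mpolyC /op_cst /op_t -!mpolyCM mulrC.
Qed.

Lemma op_s_cst j c : op_s dA j * cst c = cst c * op_s dA j.
Proof.
by rewrite /op_s mulNr mulrN -mulrA op_t_cst mulrA op_dt_cst mulrA.
Qed.

End OpAlgebra.

(** * Denominators in $D_a[s]$ and $\mathbf{k}[x]_a[s]$ *)

Section Rings.
Variables (n p : nat) (k : fieldType) (a : 'I_n -> k).
Local Notation Oa := (pseries n k).
Local Notation D := (hatD_xt n p k).
Local Notation A := (kx a).
Local Notation Aa := (kx_loc a).
Local Notation cst := (op_cst p (ps_ders n k) : Oa -> D).
Local Notation s := (@op_s n p _ (ps_ders n k) : 'I_p -> D).
Local Notation DsA := (D_s A : set D).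
Local Notation DsAa := (D_s Aa : set D).
Local Notation AsA := (A_s A : set D).
Local Notation AsAa := (A_s Aa : set D).

Lemma kx_sub_loc : A `<=` Aa.
Proof.
by move=> _ [g _ <-]; exists g, 1; rewrite meval1 oner_neq0 taylor1 mul1r.
Qed.

Lemma subring_gen_sub (R : nzRingType) (X Y : set R) :
  X `<=` subring_gen Y -> subring_gen X `<=` subring_gen Y.
Proof. by apply: subring_gen_min; apply: subring_gen_subring. Qed.

Lemma D_sub_D_s (X : set Oa) : (D_ X : set D) `<=` D_s X.
Proof. by move=> x Dx; apply: sub_subring_gen; left. Qed.

Lemma cst_D_s (X : set Oa) c : X c -> (D_s X : set D) (cst c).
Proof.
move=> Xc; apply: D_sub_D_s; apply: sub_subring_gen; left; exact: imageP.
Qed.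

Lemma cst_A_s (X : set Oa) c : X c -> (A_s X : set D) (cst c).
Proof. by move=> Xc; apply: sub_subring_gen; left; exact: imageP. Qed.

Lemma A_s_sub_D_s (X : set Oa) : (A_s X : set D) `<=` D_s X.
Proof.
apply: subring_gen_sub => x [|sx]; first by case=> c Xc <-; apply: cst_D_s.
by apply: sub_subring_gen; right.
Qed.

Lemma D_s_sub_D_t (X : set Oa) : (D_s X : set D) `<=` D_t X.
Proof.
apply: subring_gen_sub => x [Dx|[j _ <-]]; first by apply: sub_subring_gen; left.
have rDt : is_subring (D_t X : set D) := subring_gen_subring _.
rewrite -/(D_t X) /op_s; apply: (subringN rDt).
apply: (subringM rDt); apply: sub_subring_gen; right.
  by right; exists j.
by left; exists j.
Qed.

Lemma D_sS (X Y : set Oa) : X `<=` Y -> (D_s X : set D) `<=` D_s Y.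
Proof.
move=> XY; apply: subring_gen_sub => x [Dx|sx]; last by apply: sub_subring_gen; right.
apply: D_sub_D_s; apply: subring_gen_sub Dx => y [[c Xc <-]|dy].
  by apply: sub_subring_gen; left; apply: imageP; apply: XY.
by apply: sub_subring_gen; right.
Qed.

Lemma A_sS (X Y : set Oa) : X `<=` Y -> (A_s X : set D) `<=` A_s Y.
Proof.
move=> XY; apply: subring_gen_sub => x [[c Xc <-]|sx].
  by apply: cst_A_s; apply: XY.
by apply: sub_subring_gen; right.
Qed.

(** The denominators allowed in $\mathbf{k}[x]_a$, viewed as operators. They lie in $D[s]$, but
    their inverses are only available over $\mathbf{k}[x]_a$. *)
Definition units : set D :=
  [set x | exists2 h : {mpoly k[n]}, h.@[a] != 0 & x = cst (taylor a h)].

Lemma units1 : units 1.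
Proof.
exists 1; first by rewrite meval1 oner_neq0.
rewrite taylor1; exact/esym/op_cst1.
Qed.

Lemma unitsM x y : units x -> units y -> units (x * y).
Proof.
move=> [g g0 ->] [h h0 ->]; exists (g * h); first by rewrite mevalM mulf_neq0.
by rewrite taylorM op_cstM.
Qed.

Lemma unitsC x y : units x -> units y -> x * y = y * x.
Proof. by move=> [g g0 ->] [h h0 ->]; rewrite -!op_cstM mulrC. Qed.

Lemma units_A_s : units `<=` AsA.
Proof. by move=> _ [h _ ->]; apply: cst_A_s; exists h. Qed.

Lemma units_D_s : units `<=` DsA.
Proof. by move=> x /units_A_s /A_s_sub_D_s. Qed.

Lemma units_inv x : units x -> exists2 y, AsAa y & y * x = 1.
Proof.
move=> [h h0 ->]; have [v hv] := taylor_inv h0.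
exists (cst v); last by rewrite -op_cstM mulrC hv op_cst1.
(* The inverse series is the fraction $1/h$, hence an element of $\mathbf{k}[x]_a$. *)
by apply: cst_A_s; exists 1, h; rewrite hv taylor1.
Qed.

Section Clear.
Variable T : set D.
Hypotheses (rT : is_subring T) (uT : units `<=` T).

Lemma left_clears_loc c : (cst @` A) `<=` T -> Aa c -> left_clears T units (cst c).
Proof.
move=> AT [g [h [h0 hc]]].
apply: (@left_clears_gen _ _ _ rT uT unitsM unitsC (cst (taylor a h))).
- by exists h.
- by rewrite -op_cstM hc; apply: AT; apply: imageP; exists g.
- by move=> _ [g' _ ->]; rewrite -!op_cstM [c * _]mulrC subrr mulr0 mul0r.
Qed.

(** The commutator of [x] with a coefficient is again a coefficient, so it commutes with all
    denominators, as [left_clears_gen] requires. This covers $\partial_{x_i}$, and $s_j$ with [d]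
    zero. *)
Lemma left_clears_T x : T x ->
  (forall c : Oa, exists d : Oa, x * cst c = cst d + cst c * x) ->
  left_clears T units x.
Proof.
move=> Tx xc; apply: (@left_clears_gen _ _ _ rT uT unitsM unitsC 1).
- exact: units1.
- by rewrite mul1r.
- move=> _ [h _ ->]; have [d ->] := xc (taylor a h).
  by rewrite addrK -!op_cstM mulrC.
Qed.

Lemma left_clears_s j : T (s j) -> left_clears T units (s j).
Proof.
move=> Ts; apply: left_clears_T => // c; exists 0.
by rewrite op_s_cst /op_cst !mpolyC0 add0r.
Qed.

End Clear.

(** As [left_clears] defines a subring, generators suffice: a coefficient is cleared by its own
    denominator, while $\partial_{x_i}$ and $s_j$ already lie in $D[s]$. *)
Lemma clears_D_s : DsAa `<=` clears DsA units.
Proof.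
have rT : is_subring DsA := subring_gen_subring _.
have rL := left_clears_subring rT units_D_s unitsM unitsC.
move=> x Dx; apply: (left_clears1 units_D_s units1).
apply: subring_gen_min x Dx => //.
move=> x [Dx|[j _ <-]].
  apply: subring_gen_min x Dx => // x [[c Ac <-]|[i _ <-]].
  - apply: left_clears_loc => //; first exact: units_D_s.
    by move=> _ [d Ad <-]; apply: cst_D_s.
  - apply: left_clears_T => //; first exact: units_D_s.
      by apply: D_sub_D_s; apply: sub_subring_gen; right; exists i.
    by move=> c; eexists; apply: op_dx_cst.
apply: left_clears_s => //; first exact: units_D_s.
by apply: sub_subring_gen; right; exists j.
Qed.

Lemma clears_A_s : AsAa `<=` clears AsA units.
Proof.
have rT : is_subring AsA := subring_gen_subring _.
have rL := left_clears_subring rT units_A_s unitsM unitsC.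
move=> x Dx; apply: (left_clears1 units_A_s units1).
apply: subring_gen_min x Dx => //.
move=> x [[c Ac <-]|[j _ <-]].
  apply: left_clears_loc => //; first exact: units_A_s.
  by move=> _ [d Ad <-]; apply: cst_A_s.
apply: left_clears_s => //; first exact: units_A_s.
by apply: sub_subring_gen; right; exists j.
Qed.

End Rings.
Unset Implicit Arguments.

Theorem proposition1p3 (k : fieldType) (n p : nat) (a : 'I_n -> k)
    (f : 'I_p -> {mpoly k[n]}) :
  [pchar k] =i pred0 -> (1 <= n)%N -> (1 <= p)%N ->
  let F : set (hatD_xt n p k) := [set opF a f] in
  let A := kx a in
  let Aa := kx_loc a in
  let I := ann_fs a f (D_t A) in
  let J := ann_fs a f (D_t Aa) in
  let I1 := I `&` D_s A in
  let J1 := J `&` D_s Aa in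
  let I2 := set_add I1 (left_ideal (D_s A) F) `&` A_s A in
  let J2 := set_add J1 (left_ideal (D_s Aa) F) `&` A_s Aa in
  J1 = left_ideal (D_s Aa) I1 /\ J2 = left_ideal (A_s Aa) I2.
Proof.
move=> _ _ _ F A Aa I J I1 J1 I2 J2.
have rDs (X : set (pseries n k)) : is_subring (D_s X : set (hatD_xt n p k)).
  exact: subring_gen_subring.
have rAs (X : set (pseries n k)) : is_subring (A_s X : set (hatD_xt n p k)).
  exact: subring_gen_subring.
have sDs := D_sS (p := p) (kx_sub_loc (a := a)).
have sAs := A_sS (p := p) (kx_sub_loc (a := a)).
(* Since $D[s] \subseteq D\langle t,\partial_t\rangle$, membership in $I_1$ of an element of $D[s]$
   is a condition on the action alone. *)
have memI1 P : D_s A P ->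
    fs_act (ps_ders n k) (fun j => taylor a (f j)) P 1 = 0 -> I1 P.
  by move=> DP P0; split => //; split => //; apply: D_s_sub_D_t.
have memJ1 P : D_s Aa P ->
    fs_act (ps_ders n k) (fun j => taylor a (f j)) P 1 = 0 -> J1 P.
  by move=> DP P0; split => //; split => //; apply: D_s_sub_D_t.
have J1M u P : D_s Aa u -> J1 P -> J1 (u * P).
  move=> Du [[_ P0] DP]; apply: memJ1; first exact: (subringM (rDs Aa)).
  by rewrite fs_actM P0 fs_act0.
have J1D P Q : J1 P -> J1 Q -> J1 (P + Q).
  move=> [[_ P0] DP] [[_ Q0] DQ]; apply: memJ1; first exact: (subringD (rDs Aa)).
  by rewrite fs_actDl P0 Q0 addr0.
have J10 : J1 0.
  by apply: memJ1; [exact: (subring0 (rDs Aa)) | exact: op_act0].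
have I1J1 : I1 `<=` J1 by move=> P [[_ P0] DP]; apply: memJ1 => //; apply: sDs.
have unitM (h P : hatD_xt n p k) : units a h -> J1 P -> D_s A (h * P) -> I1 (h * P).
  move=> uh J1P DhP; apply: memI1 => //.
  suff [[_ hP0] _] : J1 (h * P) by [].
  by apply: J1M => //; apply: sDs; apply: units_D_s.
split; apply/seteqP; split.
(* Write $P = h^{-1}(hP)$ with $hP \in I_1$; [v] is $h^{-1}$. *)
- move=> P J1P; have [h uh DhP] := clears_D_s J1P.2.
  have [v Av vh] := units_inv uh; rewrite -[P]mul1r -vh -mulrA.
  by apply: left_ideal_mul; [apply: A_s_sub_D_s | apply: unitM].
- by apply: left_ideal_min => // u P Du /I1J1; apply: J1M.
- move=> b [[P [Q [J1P /(left_ideal1P _ _ (rDs Aa))[q Dq ->] eb]]] Ab].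
  have [h1 u1 Dh1] := clears_D_s J1P.2; have [h2 u2 Dh2] := clears_D_s Dq.
  have [h3 u3 Ah3] := clears_A_s Ab.
  (* [h1], [h2], [h3] clear $P$, $q$ and $b$ in $b = P + qF$. The factors of [h] commute, so each
     can be put next to the element it clears. *)
  pose h := h1 * (h2 * h3); have uh : units a h by do !apply: unitsM.
  have e1 : h = h2 * h3 * h1 := unitsC u1 (unitsM u2 u3).
  have e2 : h = h1 * h3 * h2.
    exact: etrans (congr1 _ (unitsC u2 u3)) (mulrA _ _ _).
  have e3 : h = h1 * h2 * h3 := mulrA _ _ _.
  have hP : D_s A (h * P).
    rewrite e1; exact: (subringMA (rDs A) (units_D_s (unitsM u2 u3)) Dh1).
  have hq : D_s A (h * q).
    rewrite e2; exact: (subringMA (rDs A) (units_D_s (unitsM u1 u3)) Dh2).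
  have hb : A_s A (h * b).
    rewrite e3; exact: (subringMA (rAs A) (units_A_s (unitsM u1 u2)) Ah3).
  have I2hb : I2 (h * b).
    split; last exact: hb.
    exists (h * P), (h * q * opF a f); split; first exact: (unitM _ _ uh J1P hP).
      exact: (left_ideal_mul hq).
    by rewrite eb; exact: mulrDMA.
  have [v Av vh] := units_inv uh; rewrite -[b]mul1r -vh -mulrA.
  exact: (left_ideal_mul Av I2hb).
(* It suffices that $J_2$ contains $0$, is closed under sums, and contains $u(P + qF) = uP + (uq)F$
   for $u \in \mathbf{k}[x]_a[s]$ and $P + qF \in I_2$. *)
- apply: left_ideal_min.
  + split; last exact: (subring0 (rAs Aa)).
    exists 0, 0; split; [exact: J10 | | exact/esym/addr0].
    apply/(left_ideal1P _ _ (rDs Aa)); exists 0; last exact/esym/mul0r.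
    exact: (subring0 (rDs Aa)).
  + move=> y y' [[P [Q [JP /(left_ideal1P _ _ (rDs Aa))[q Dq ->] ey]]] Ay].
    move=> [[P' [Q' [JP' /(left_ideal1P _ _ (rDs Aa))[q' Dq' ->] ey']]] Ay'].
    split; last exact: (subringD (rAs Aa)).
    exists (P + P'), ((q + q') * opF a f); split; first exact: J1D.
      by apply: left_ideal_mul; [exact: (subringD (rDs Aa)) | exact: erefl].
    by rewrite ey ey'; exact: addrDMl.
  + move=> u y Au [[P [Q [IP /(left_ideal1P _ _ (rDs A))[q Dq ->] ey]]] Ab].
    have Du := A_s_sub_D_s Au.
    split; last exact: (subringM (rAs Aa) Au (sAs _ Ab)).
    exists (u * P), (u * q * opF a f); split; first exact: (J1M _ _ Du (I1J1 _ IP)).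
      apply: left_ideal_mul; last exact: erefl.
      exact: (subringM (rDs Aa) Du (sDs _ Dq)).
    by rewrite ey; exact: mulrDMA.
Qed.
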